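(* Let $m \geq 3$ be an integer. Then \[ \alpha(C(C_{m}))=\begin{cases} k(k+1)+\left\lfloor (k+1)/2\right\rfloor & \text{if } m=2k+1,\\ k(k+1) & \text{if } m=2k,\end{cases} \] where $k$ is an integer.
   Context: Graphs are finite and simple. For a graph $G$, the pair graph $C(G)$ (also called complete double vertex graph) is the graph whose vertices are all $2$-multisets of $V(G)$ (so $\{x,x\}$ is allowed), where two vertices $\{x,y\}$ and $\{u,v\}$ are adjacent if and only if $\{x,y\}\cap\{u,v\}=\{a\}$ (multiset intersection) for some $a$ and, writing $x=u=a$, the vertices $y$ and $v$ are adjacent in $G$; that is, the two multisets can be written as $\{a,y\}$ and $\{a,v\}$ with $yv$ an edge of $G$. $C_m$ is the cycle with $m$ vertices, and $C(C_m)$ is its pair graph. $\alpha(G)$ denotes the independence number of $G$. *)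

(* Defs.v *)
From HB Require Import structures.
From mathcomp Require Import all_boot.
From mathcomp Require Import finmap multiset.

Set Implicit Arguments.
Unset Strict Implicit.
Unset Printing Implicit Defensive.

Local Open Scope mset_scope.

Record sgraph := SGraph {
  vertex :> finType;
  edge : rel vertex;
  edge_sym : symmetric edge;
  edge_irrefl : irreflexive edge }.

Definition independent (G : sgraph) (S : {set G}) : bool :=
  [forall x in S, forall y in S, ~~ edge x y].

Definition alpha (G : sgraph) : nat := \max_(S : {set G} | independent S) #|S|.

(* [size A] goes through the coercion [enum_mset], so it counts elements with
   multiplicity. *)
Record mset2 (T : finType) := MSet2 {
  mset2_val :> {mset T};
  _ : size mset2_val == 2 }.

HB.instance Definition _ (T : finType) := [isSub for @mset2_val T].
HB.instance Definition _ (T : finType) := [Choice of mset2 T by <:].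

Definition mset2_tuple (T : finType) (A : mset2 T) : 2.-tuple T :=
  Tuple (valP A).

Definition tuple_mset2 (T : finType) (t : 2.-tuple T) : option (mset2 T) :=
  insub (seq_mset t).

Lemma mset2_tupleK (T : finType) :
  pcancel (@mset2_tuple T) (@tuple_mset2 T).
Proof. by move=> A; rewrite /tuple_mset2 /= seq_mset_id valK. Qed.

HB.instance Definition _ (T : finType) :=
  PCanIsCountable (@mset2_tupleK T).
HB.instance Definition _ (T : finType) :=
  isFinite.Build (mset2 T) (pcan_enumP (@mset2_tupleK T)).

Section PairGraph.

Variable G : sgraph.

Definition pair_edge (A B : mset2 G) : bool :=
  [exists a : G, (A `&` B == [mset a]) &&
    [exists y : G, exists v : G,
      [&& mset2_val A == [mset a; y], mset2_val B == [mset a; v] & edge y v]]].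

Lemma pair_edge_sym : symmetric pair_edge.
Proof.
suff sub A B : pair_edge A B -> pair_edge B A.
  by move=> A B; apply/idP/idP; apply: sub.
case/existsP=> a /andP[AB] /existsP[y] /existsP[v] /and3P[Ay Bv yv].
apply/existsP; exists a; rewrite msetIC AB /=.
by apply/existsP; exists v; apply/existsP; exists y; rewrite Ay Bv edge_sym.
Qed.

Lemma pair_edge_irrefl : irreflexive pair_edge.
Proof.
move=> A; apply/negbTE/negP; case/existsP=> a /andP[/eqP].
by rewrite msetIid => Aa _; have := valP A; rewrite /= Aa enum_msetn.
Qed.

Definition pair_graph : sgraph := SGraph pair_edge_sym pair_edge_irrefl.

End PairGraph.

(* For [3 <= m] the conjunct [i != j] is implied by the other one; it only
   prevents the loop at [m = 1]. *)
Definition cycle_edge (m : nat) (i j : 'I_m) : bool :=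
  (i != j) && ((j == i.+1 %% m :> nat) || (i == j.+1 %% m :> nat)).

Lemma cycle_edge_sym m : symmetric (@cycle_edge m).
Proof. by move=> i j; rewrite /cycle_edge eq_sym orbC. Qed.

Lemma cycle_edge_irrefl m : irreflexive (@cycle_edge m).
Proof. by move=> i; rewrite /cycle_edge eqxx. Qed.

Definition cycle_graph (m : nat) : sgraph :=
  SGraph (@cycle_edge_sym m) (@cycle_edge_irrefl m).

(* Main.v *)
(* Write [k] for the integer part of [m / 2] and sort the 2-multisets of vertices
   by the length [d <= k] of the shortest arc of the cycle joining the two points.
   Lengthening an arc at its end pairs arcs of length [d] with arcs of length
   [d + 1] by edges, so an independent set has at most [m] arcs in two consecutive
   layers, and it has at most [k] arcs of length [k]: for even [m] there are no
   more, and for odd [m] shifting the start by [k + 1] moves an arc of length [k]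
   to an adjacent one.  The bound is attained by the arcs of even length, those of
   length [k] being taken only when they start below [k]. *)
Require Import Defs.
From mathcomp Require Import all_boot.
From mathcomp Require Import finmap multiset.
From mathcomp Require Import zify.

Set Implicit Arguments.
Unset Strict Implicit.
Unset Printing Implicit Defensive.

(** * Multisets of size two as unordered pairs *)

Section Mset2.

Variable T : finType.
Implicit Types x y u v : T.

Lemma mset2_seqE x y : [mset x; y]%mset = seq_mset [:: x; y].
Proof.
apply/msetP => z.
by rewrite mset_seqE mset1DE msetnE /= ![z == _]eq_sym addn0; case: (y == z).
Qed.

Lemma size_mset2 x y : size [mset x; y]%mset == 2.
Proof. by rewrite mset2_seqE (perm_size (perm_eq_seq_mset _)). Qed.

Definition mpair x y : mset2 T := MSet2 (size_mset2 x y).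

Lemma mpairC x y : mpair x y = mpair y x.
Proof. by apply: val_inj; rewrite /= msetDC. Qed.

Lemma mpair_inj x y u v :
  mpair x y = mpair u v -> (x = u /\ y = v) \/ (x = v /\ y = u).
Proof.
move=> /(congr1 val) /=; rewrite !mset2_seqE => /eq_seq_msetP.
have perm1 w z : perm_eq [:: w] [:: z] -> w = z :> T.
  by move/perm_mem/(_ w); rewrite !inE eqxx => /esym/eqP.
move=> p; have := perm_mem p x; rewrite !inE eqxx /= => /esym/orP[]/eqP ex.
  by left; move: p; rewrite ex perm_cons => /perm1.
right; split=> //; apply: perm1; rewrite -(perm_cons v) -{1}ex.
by rewrite (perm_trans p) // (perm_catC [:: u] [:: v]).
Qed.

Lemma mpair_surj (A : mset2 T) : exists x y, A = mpair x y.
Proof.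
have := valP A; rewrite /=; have := seq_mset_id (val A).
case: (enum_mset (val A)) => [|x [|y [|]]] // eA _.
by exists x, y; apply: val_inj; rewrite /= mset2_seqE.
Qed.

End Mset2.

Lemma pair_edgeP (G : sgraph) (A B : mset2 G) :
  reflect (exists a y v, [/\ A = mpair a y, B = mpair a v & edge y v])
          (pair_edge A B).
Proof.
apply: (iffP existsP) => [[a /andP[_ /existsP[y /existsP[v /and3P[eA eB yv]]]]]|].
  by exists a, y, v; split=> //; apply: val_inj; exact/eqP.
move=> [a [y [v [-> -> yv]]]]; exists a; apply/andP; split; last first.
  by apply/existsP; exists y; apply/existsP; exists v; rewrite /= !eqxx.
apply/eqP/msetP => z; rewrite /= msetE2 !mset1DE !msetnE.
(* The ends of an edge differ, so the two multisets share [a] exactly once, even when [a] is [y] or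
   [v]. *)
have : y != v by apply: contraTneq yv => ->; rewrite edge_irrefl.
case: (z =P y) => [->|_ _]; first by move/negbTE->; case: (_ == a).
by case: (_ == a); case: (_ == v).
Qed.

(** * Arcs of the cycle as vertices of the pair graph *)

Section PairCycle.

Variable m : nat.
Hypothesis m_gt2 : 2 < m.

Let m_gt0 : 0 < m. Proof. exact: ltn_trans m_gt2. Qed.

Local Notation C := (pair_graph (cycle_graph m)).

(** Makes residues linear, so that [lia] can settle the case analyses on endpoints. *)
Lemma modn_wrap n : n < m.*2 -> n %% m = if n < m then n else n - m.
Proof.
case: (ltnP n m) => [/modn_small //|mn n2m].
by rewrite -[in LHS](subnK mn) modnDr modn_small; lia.
Qed.

Definition cyc n : 'I_m := Ordinal (ltn_pmod n m_gt0).

Lemma cycE n p : n = p %[mod m] -> cyc n = cyc p.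
Proof. by move=> e; apply: val_inj. Qed.

Lemma cyc_ord (x : 'I_m) : cyc x = x.
Proof. by apply: val_inj; rewrite /= modn_small. Qed.

Lemma edge_cyc n : edge (cyc n : cycle_graph m) (cyc n.+1).
Proof.
rewrite /= /cycle_edge -val_eqE /=.
have -> : n.+1 %% m = (n %% m).+1 %% m by rewrite -addn1 -modnDml addn1.
by have := ltn_pmod n m_gt0; rewrite eqxx [_.+1 %% m]modn_wrap;
  [move: (n %% m) => r; case: ifP; lia | lia].
Qed.

Definition arc n d : C := mpair (cyc n) (cyc (n + d)).

Lemma arc_mod n d : arc (n %% m) d = arc n d.
Proof. by congr mpair; apply: cycE; rewrite ?modn_mod ?modnDml. Qed.

Lemma edge_arc_len n d : edge (arc n d) (arc n d.+1).
Proof.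
apply/pair_edgeP; exists (cyc n), (cyc (n + d)), (cyc (n + d.+1)).
by split; rewrite // addnS; apply: edge_cyc.
Qed.

Local Notation k := m./2.

(** The two arcs between two vertices have lengths summing to [m], so one of them is at most [k]. *)
Lemma arc_surj (A : C) : exists n d, d <= k /\ A = arc n d.
Proof.
have [x [y ->]] := mpair_surj (A : mset2 _).
wlog lexy : x y / x <= y.
  move=> H; case: (leqP x y) => [/H //|/ltnW/H[n [d [dk e]]]].
  by exists n, d; rewrite mpairC.
have [d_le|d_gt] := leqP (y - x) k.
  exists x, (y - x); split=> //.
  by rewrite /arc subnKC // !cyc_ord.
exists y, (m - (y - x)); split; first by have := ltn_ord y; lia.
rewrite mpairC /arc cyc_ord; congr mpair; rewrite -[LHS]cyc_ord; apply: cycE.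
by rewrite -(modnDr x); congr (_ %% _); have := ltn_ord y; lia.
Qed.

Definition layer d : {set C} := [set arc (x : 'I_m) d | x : 'I_m].

Lemma arc_layer n d : arc n d \in layer d.
Proof. by rewrite -arc_mod; apply/imsetP; exists (cyc n). Qed.

Lemma indepP (S : {set C}) A B :
  independent S -> A \in S -> B \in S -> edge A B -> False.
Proof. by move=> /forall_inP/(_ A) H /H/forall_inP/(_ B) H' /H'/negP. Qed.

(** * Upper bound *)

Lemma card_layer2 (S : {set C}) d :
  independent S -> #|S :&: (layer d :|: layer d.+1)| <= m.
Proof.
(* The two arcs starting at [x] are adjacent, so [S] contains at most one of them, and then it is
   [f x]. *)
move=> indS; pose f (x : 'I_m) := if arc x d \in S then arc x d else arc x d.+1.
have /leq_trans : #|S :&: (layer d :|: layer d.+1)| <= #|f @: setT|.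
  apply/subset_leq_card/subsetP => A; rewrite !inE => /andP[AS].
  case/orP=> /imsetP[x _ eA]; apply/imsetP; exists x; rewrite // /f.
    by rewrite -eA AS.
  case: ifP => // xS; case: (indepP indS xS AS).
  by rewrite eA; apply: edge_arc_len.
by apply; rewrite (leq_trans (leq_imset_card _ _)) // cardsT card_ord.
Qed.

Lemma card_layers (S : {set C}) j :
  independent S -> #|S :&: \bigcup_(d < j.*2) layer d| <= m * j.
Proof.
move=> indS; elim: j => [|j IHj]; first by rewrite big_ord0 setI0 cards0.
rewrite doubleS !big_ord_recr /= -setUA setIUr mulnS addnC.
by rewrite (leq_trans (leq_card_setU _ _)) // leq_add ?card_layer2.
Qed.

Lemma card_last_layer (S : {set C}) : independent S -> #|S :&: layer k| <= k.
Proof.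
move=> indS; have [odd_m|even_m] := boolP (odd m); last first.
  (* Here [m] is twice [k], so the arcs of length [k] from [x] and from [x + k] have the same ends,
     and starts below [k] suffice. *)
  pose f (x : 'I_k) := arc x k.
  have /leq_trans : #|S :&: layer k| <= #|f @: setT|.
    apply/subset_leq_card/subsetP => A; rewrite !inE => /andP[_].
    case/imsetP => x _ ->; apply/imsetP.
    have [xk|kx] := ltnP x k; first by exists (Ordinal xk).
    have xk : x - k < k by have := ltn_ord x; lia.
    exists (Ordinal xk) => //; rewrite /f /arc /= subnK // mpairC.
    congr mpair; apply: cycE; rewrite -[RHS]modnDr; congr (_ %% _); lia.
  by apply; rewrite (leq_trans (leq_imset_card _ _)) // cardsT card_ord.
pose T := [set x : 'I_m | arc x k \in S].
pose g (x : 'I_m) := cyc (x + k.+1).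
have g_inj : injective g.
  move=> x y /(congr1 val) /= /eqP; rewrite eqn_modDr !modn_small //.
  by move/eqP/val_inj.
(* The arc of length [k] from [x + k.+1] ends at [x], as [m] is [k + k.+1]. It shares [x] with the
   arc from [x], and their other ends [x + k.+1] and [x + k] are adjacent. *)
have dTg : [disjoint T & g @: T].
  rewrite disjoint_sym disjoints_subset; apply/subsetP => _ /imsetP[x xT ->].
  rewrite !inE in xT *; apply/negP; rewrite arc_mod => gS.
  apply: (indepP indS xT gS); apply/pair_edgeP.
  exists (cyc x), (cyc (x + k)), (cyc (x + k.+1)); split=> //.
    rewrite /arc mpairC; congr mpair; apply: cycE; rewrite -[RHS]modnDr.
    by congr (_ %% _); lia.
  by rewrite addnS edge_cyc.
have ST : #|S :&: layer k| <= #|T|.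
  rewrite (leq_trans _ (leq_imset_card (fun x : 'I_m => arc x k) _)) //.
  apply/subset_leq_card/subsetP => A; rewrite !inE => /andP[AS].
  by case/imsetP => x _ eA; apply/imsetP; exists x; rewrite // inE -eA.
have : #|T| + #|g @: T| <= m.
  rewrite -cardsUI (disjoint_setI0 dTg) cards0 addn0.
  by rewrite -[m in leqRHS]card_ord max_card.
rewrite card_imset //; lia.
Qed.

(** For odd [k] the layers [0] to [k] split into consecutive pairs; for even [k] the last one is
    left over and is bounded separately. *)
Lemma alpha_le : alpha C <= m * (k.+1)./2 + (~~ odd k) * k.
Proof.
apply/bigmax_leqP => S indS.
have subS : S \subset \bigcup_(d < k.+1) layer d.
  apply/subsetP => A _; have [n [d [dk ->]]] := arc_surj A.
  by apply/bigcupP; exists (inord d); rewrite // inordK ?ltnS // arc_layer.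
rewrite -(setIidPl subS); have [odd_k|even_k] := boolP (odd k).
  have -> : k.+1 = ((k.+1)./2).*2 by lia.
  by rewrite addn0 (half_bit_double _ false) card_layers.
have eK : k = ((k.+1)./2).*2 by lia.
rewrite big_ord_recr /= setIUr mul1n (leq_trans (leq_card_setU _ _)) //.
rewrite leq_add ?card_last_layer // [in X in #|_ :&: X|]eK.
exact: card_layers.
Qed.

(** * Lower bound *)

(* For even [m], bounding the start makes the representation of an arc of length
   [k] unique; for odd [m], it makes the arcs of length [k] independent. *)
Definition evenarc (p : 'I_m * 'I_k.+1) :=
  ~~ odd p.2 && ((p.2 == k :> nat) ==> (p.1 < k)).

(** Distinct arcs with the same ends are complementary. Lengths at most [k] then force [m] even and
    both lengths [k], with starts [k] apart, which cannot both be below [k]. *)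
Lemma arc_inj : {in evenarc &, injective (fun p : 'I_m * 'I_k.+1 => arc p.1 p.2)}.
Proof.
move=> [x d] [y e]; rewrite !unfold_in /= => /andP[dE dk] /andP[eE ek].
have [xm ym] := (ltn_ord x, ltn_ord y); have [lk le_k] := (ltn_ord d, ltn_ord e).
suff H : arc x d = arc y e -> x = y :> nat /\ d = e :> nat.
  by move/H => [/val_inj -> /val_inj ->].
rewrite /arc !cyc_ord => /mpair_inj[] [/(congr1 val) /= h1 /(congr1 val) /= h2].
  by move: h1 h2; rewrite !modn_wrap; repeat case: ifP => ?; lia.
by move: h1 h2; rewrite !modn_wrap; repeat case: ifP => ?; lia.
Qed.

(** Distances from a common end [a] to two adjacent vertices differ by one, hence are not both even,
    unless [m] is odd and both are [k]. In that case the starts are [a] and [a + k.+1] modulo [m],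
    not both below [k]. *)
Lemma independent_evenarc :
  independent [set arc p.1 p.2 | p : 'I_m * 'I_k.+1 in evenarc].
Proof.
apply/forall_inP => _ /imsetP[[x d] xd ->].
apply/forall_inP => _ /imsetP[[y e] ye ->].
move: xd ye; rewrite !unfold_in /= => /andP[dE dk] /andP[eE ek].
have [xm ym] := (ltn_ord x, ltn_ord y); have [lk le_k] := (ltn_ord d, ltn_ord e).
apply/negP => /pair_edgeP[a [b [c []]]].
have [am bm] := (ltn_ord a, ltn_ord b); have cm := ltn_ord c.
rewrite /= /cycle_edge /arc !cyc_ord => /mpair_inj h1 /mpair_inj h2 /andP[_].
case: h1 h2 => [] [/(congr1 val) /= h1 /(congr1 val) /= h1'];
  case=> [] [/(congr1 val) /= h2 /(congr1 val) /= h2']; move: h1 h1' h2 h2';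
  rewrite !modn_wrap; by [lia | repeat case: ifP => ?; lia].
Qed.

Lemma sum_even n : \sum_(d < n) ~~ odd d = uphalf n.
Proof. by elim: n => [|n IHn]; rewrite ?big_ord0 // big_ord_recr /= IHn; lia. Qed.

Lemma card_evenarc : #|evenarc| = m * (k.+1)./2 + (~~ odd k) * k.
Proof.
have -> : #|evenarc| = \sum_(d < k.+1) \sum_(x < m) evenarc (x, d).
  rewrite exchange_big pair_bigA -sum1_card big_mkcond /=.
  by apply: eq_bigr => -[x d] _; rewrite unfold_in /evenarc; case: (_ && _).
(* [(k.+1)./2] computes to [uphalf k], the number of even lengths below [k]; each of them allows all
   [m] starts. *)
rewrite big_ord_recr /= -sum_even big_distrr /=; congr (_ + _).
  apply: eq_bigr => d _; rewrite -[X in X * _]card_ord -sum_nat_const.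
  by apply: eq_bigr => x _; rewrite /evenarc /= (ltn_eqF (ltn_ord d)) andbT.
have km : k <= m by lia.
transitivity (\sum_(x < k) ~~ odd k); last by rewrite sum_nat_const card_ord mulnC.
rewrite (big_ord_widen m (fun=> _) km) [RHS]big_mkcond /=; apply: eq_bigr => x _.
by rewrite /evenarc /= eqxx /=; case: (x < k); rewrite ?andbT ?andbF.
Qed.

Lemma alpha_pair_cycle : alpha C = m * (k.+1)./2 + (~~ odd k) * k.
Proof.
apply/eqP; rewrite eqn_leq alpha_le -card_evenarc -(card_in_imset arc_inj).
by rewrite /alpha (leq_bigmax_cond _ independent_evenarc).
Qed.

End PairCycle.

Theorem theorem1p5 (m : nat) (hm : 3 <= m) :
  (forall k : nat, m = 2 * k + 1 ->
     alpha (pair_graph (cycle_graph m)) = k * (k + 1) + (k + 1) %/ 2) /\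
  (forall k : nat, m = 2 * k ->
     alpha (pair_graph (cycle_graph m)) = k * (k + 1)).
Proof.
rewrite alpha_pair_cycle //.
have halfS j : (j.*2.+2)./2 = j.+1 /\ (j.*2.+1)./2 = j by lia.
split=> k em.
  have -> : m./2 = k by lia.
  (* Splitting [k] into its parity and [k./2.*2] evaluates the halves, leaving polynomial identities
     in [k./2]. *)
  rewrite em -(odd_double_half k) addn1 divn2; case: (odd k).
    by rewrite add1n oddS odd_double (halfS _).1; nia.
  by rewrite add0n odd_double (halfS _).2; nia.
have -> : m./2 = k by lia.
rewrite em -(odd_double_half k) addn1; case: (odd k).
  by rewrite add1n oddS odd_double (halfS _).1; nia.
by rewrite add0n odd_double (halfS _).2; nia.
Qed.
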